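(* Let $K$ be an alphabet space, $\sigma:K\to K^+$ a primitive generalized substitution, and $(X_\sigma,S)$ the generalized subshift it generates. Then: (1) $(X_\sigma,S)$ is minimal; (2) if moreover $\sigma$ is recognizable and aperiodic, then $(X_\sigma,S)$ is a self-induced minimal Cantor system, and $\sigma$ (acting on sequences) is a conjugacy from $(X_\sigma,S)$ to the induced system $(\sigma(X_\sigma),S_{\sigma(X_\sigma)})$.
   Context: An alphabet space is a compact zero-dimensional metric space $K$ with at least two points; $K^n$ is the set of words of length $n$ (with product topology), $K^+=\bigcup_{n\ge1}K^n$. A generalized substitution is a map $\sigma:K\to K^+$ such that $a\mapsto|\sigma(a)|$ is continuous and, for each $j$, the map $a\mapsto$ ($j$-th letter of $\sigma(a)$) is continuous on $\{a:|\sigma(a)|\ge j\}$. It extends to $K^+$ by concatenation (so it can be iterated) and to $K^{\mathbb Z}$ by $\sigma(\ldots x_{-1}.x_0x_1\ldots)=\ldots\sigma(x_{-1}).\sigma(x_0)\sigma(x_1)\ldots$ with $\sigma(x_0)$ starting at coordinate $0$. $\sigma$ is primitive if for every nonempty open $V\subset K$ there is $j$ such that for all $a\in K$ and all $k\ge j$ some letter of $\sigma^k(a)$ lies in $V$. The language $\mathcal L(\sigma,a)$ is the set of words $w\in K^+$ that are subwords of some $\sigma^j(a)$, $j\in\mathbb N$, or limits in $K^{|w|}$ of such words; $\mathcal L(\sigma)=\bigcup_{a\in K}\mathcal L(\sigma,a)$. $X_\sigma=\{\mathbf x\in K^{\mathbb Z}:\mathbf x[-n,n]\in\mathcal L(\sigma)\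 \forall n\ge0\}$, with the shift $S(\mathbf x)_i=x_{i+1}$. $\sigma$ is aperiodic if $X_\sigma$ contains no $S$-periodic point. $\sigma$ is recognizable if for every $\mathbf z\in X_\sigma$ there is a unique set of integers $\{n_k:k\in\mathbb Z\}$ and a unique $\mathbf x\in X_\sigma$ with $\sigma(x_k)=\mathbf z[n_k,n_{k+1}-1]$ for all $k$. For a minimal Cantor system $(X,T)$ and clopen $U$, the induced map is $T_U(x)=T^{r_U(x)}x$ with $r_U(x)=\inf\{n>0:T^nx\in U\}$; $(X,T)$ is self-induced if $(U,T_U)$ is conjugate to $(X,T)$ for some nonempty clopen $U\subsetneq X$. *)

(* Defs.v *)
From HB Require Import structures.
From mathcomp Require Import all_boot all_order all_algebra.
From mathcomp Require Import all_classical all_reals topology.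
Set Implicit Arguments. Unset Strict Implicit. Unset Printing Implicit Defensive.
Import Order.TTheory GRing.Theory Num.Theory.
Local Open Scope classical_set_scope.
Local Open Scope ring_scope.

(* (a Hausdorff pseudometric space is a metric space).                      *)
Definition alphabet_space {R : realType} (K : pseudoMetricType R) : Prop :=
  [/\ hausdorff_space K, compact [set: K], zero_dimensional K &
      exists a b : K, a <> b].

(*  - a |-> |sigma a| is continuous (into the discrete space nat);          *)
Definition gen_substitution {K : topologicalType} (sigma : K -> seq K) : Prop :=
  [/\ forall a, (0 < size (sigma a))%N,
      forall n : nat, open [set a | size (sigma a) = n] &
      forall j : nat, {within [set a | (j < size (sigma a))%N],
                        continuous (fun a => nth a (sigma a) j)}].

Definition subst_word {K : Type} (sigma : K -> seq K) (w : seq K) : seq K :=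
  flatten (map sigma w).
Definition subst_iter {K : Type} (sigma : K -> seq K) (j : nat) (a : K) : seq K :=
  iter j (subst_word sigma) [:: a].

Definition subword {K : Type} (u s : seq K) : Prop :=
  exists p q, s = p ++ u ++ q.

Definition primitive_subst {K : topologicalType} (sigma : K -> seq K) : Prop :=
  forall V : set K, open V -> V !=set0 ->
    exists j : nat, forall (a : K) (k : nat), (j <= k)%N ->
      exists i : nat, (i < size (subst_iter sigma k a))%N /\
                      V (nth a (subst_iter sigma k a) i).

(* The language L(sigma, a): nonempty words that are subwords of some      *)
(* sigma^j(a), or limits in K^|w| (product topology) of such words, i.e.   *)
(* the closure in K^|w| of that set of words, written with the metric.     *)
Definition language_at {R : realType} {K : pseudoMetricType R}
    (sigma : K -> seq K) (a : K) (w : seq K) : Prop :=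
  (0 < size w)%N /\
  forall e : R, 0 < e ->
    exists u : seq K, [/\ (exists j, subword u (subst_iter sigma j a)),
       size u = size w &
       forall i : nat, (i < size w)%N -> ball (nth a w i) e (nth a u i)].

Definition language {R : realType} {K : pseudoMetricType R}
    (sigma : K -> seq K) (w : seq K) : Prop :=
  exists a : K, language_at sigma a w.

Definition KZ (K : topologicalType) := {ptws int -> K}.

Definition window {K : Type} (x : int -> K) (n : nat) : seq K :=
  [seq x (i%:Z - n%:Z) | i <- iota 0 (n + n).+1].

Definition Xsigma {R : realType} {K : pseudoMetricType R}
    (sigma : K -> seq K) : set (KZ K) :=
  [set x | forall n : nat, language sigma (window x n)].

Definition shift {K : topologicalType} (x : KZ K) : KZ K := fun i => x (i + 1).

(* sigma acting on sequences: sigma(x_k) is placed starting at coordinate *)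
(* bpos x k, with bpos x 0 = 0, bpos x (k+1) = bpos x k + |sigma(x_k)|.   *)
Definition blen {K : Type} (sigma : K -> seq K) (x : int -> K) (i : int) : int :=
  (size (sigma (x i)))%:Z.
Definition bpos {K : Type} (sigma : K -> seq K) (x : int -> K) (k : int) : int :=
  match k with
  | Posz n => \sum_(i < n) blen sigma x i%:Z
  | Negz n => - \sum_(i < n.+1) blen sigma x (- (i.+1)%:Z)
  end.
Definition subst_seq_rel {K : Type} (sigma : K -> seq K) (x y : int -> K) : Prop :=
  forall (k : int) (j : nat), (j < size (sigma (x k)))%N ->
    y (bpos sigma x k + j%:Z) = nth (x k) (sigma (x k)) j.
(* the (unique, when sigma is a generalized substitution) y with          *)
(* y = ... sigma(x_-1) . sigma(x_0) sigma(x_1) ...                         *)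
Definition subst_seq {K : topologicalType} (sigma : K -> seq K) (x : KZ K) : KZ K :=
  xget x [set y : KZ K | subst_seq_rel sigma x y].

Definition cut {K : Type} (z : int -> K) (a b : int) : seq K :=
  if a < b then [seq z (a + i%:Z) | i <- iota 0 `|b - a|%N] else [::].

(* recognizability; the indexing of (n_k) is normalized by n_0 <= 0 < n_1 *)
Definition recognizable {R : realType} {K : pseudoMetricType R}
    (sigma : K -> seq K) : Prop :=
  forall z : KZ K, Xsigma sigma z ->
    exists! nx : (int -> int) * KZ K,
      [/\ Xsigma sigma nx.2, nx.1 0 <= 0 < nx.1 1 &
          forall k : int, sigma (nx.2 k) = cut z (nx.1 k) (nx.1 (k + 1))].

Definition aperiodic {R : realType} {K : pseudoMetricType R}
    (sigma : K -> seq K) : Prop :=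
  ~ exists x : KZ K, Xsigma sigma x /\
      exists p : nat, (0 < p)%N /\ iter p shift x = x.

Definition rel_open {T : topologicalType} (X U : set T) : Prop :=
  exists V, open V /\ U = X `&` V.
Definition rel_closed {T : topologicalType} (X C : set T) : Prop :=
  exists V, closed V /\ C = X `&` V.
Definition rel_clopen {T : topologicalType} (X U : set T) : Prop :=
  rel_open X U /\ rel_closed X U.

Definition homeo_on {T T' : topologicalType} (X : set T) (Y : set T')
    (f : T -> T') : Prop :=
  [/\ forall x, X x -> Y (f x), {within X, continuous f} &
      exists g : T' -> T,
        [/\ forall y, Y y -> X (g y), forall x, X x -> g (f x) = x,
            forall y, Y y -> f (g y) = y & {within Y, continuous g}]].

Definition minimal_system {T : topologicalType} (X : set T) (f : T -> T) : Prop :=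
  [/\ X !=set0, forall x, X x -> X (f x) &
      forall C, rel_closed X C -> C !=set0 -> (forall x, C x -> C (f x)) ->
        C = X].

(* X is a Cantor space: nonempty, compact, zero-dimensional (clopen base), *)
(* without isolated points (metrizability and Hausdorffness come from the  *)
(* ambient space K^Z).                                                     *)
Definition cantor_set {T : topologicalType} (X : set T) : Prop :=
  [/\ X !=set0, compact X,
      (forall x V, X x -> open V -> V x ->
         exists U, [/\ rel_clopen X U, U x & U `<=` V]) &
      (forall x V, X x -> open V -> V x -> exists y, [/\ X y, V y & y <> x])].

Definition minimal_cantor_system {T : topologicalType} (X : set T) (f : T -> T) :=
  [/\ cantor_set X, homeo_on X X f & minimal_system X f].

Definition first_return {T : Type} (f : T -> T) (U : set T) (x y : T) : Prop :=
  exists n : nat, [/\ (0 < n)%N, y = iter n f x, U y &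
    forall m : nat, (0 < m < n)%N -> ~ U (iter m f x)].

Definition conj_to_induced {T : topologicalType} (X : set T) (f : T -> T)
    (U : set T) (phi : T -> T) : Prop :=
  homeo_on X U phi /\ forall x, X x -> first_return f U (phi x) (phi (f x)).

Definition self_induced {T : topologicalType} (X : set T) (f : T -> T) : Prop :=
  exists U : set T, [/\ rel_clopen X U, U !=set0, U <> X &
                        exists phi, conj_to_induced X f U phi].

(* Main.v *)
Require Import Defs.
From HB Require Import structures.
From mathcomp Require Import all_boot all_order all_algebra.
From mathcomp Require Import all_classical all_reals topology.
From mathcomp Require Import zify.
Set Implicit Arguments. Unset Strict Implicit. Unset Printing Implicit Defensive.
Import Order.TTheory GRing.Theory Num.Theory.
Local Open Scope classical_set_scope.

(** Minimality: a word [w] of the language is, up to [e], a subword of some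
    [sigma^j(a)], hence of [sigma^j(b)] for all [b] near [a]; by primitivity it
    occurs up to [e] in [sigma^q(b)] for a fixed [q] and every letter [b]. Every
    long enough word of the language contains a full block [sigma^q(b)], so [w]
    recurs in all of them.

    Induced system: recognizability makes [X] the disjoint union, over [m], of
    the compact sets [S^m sigma({x in X : m < |sigma(x_0)|})], finitely many of
    which are nonempty. Hence [sigma(X)] is clopen in [X], [sigma] is injective
    on [X], and the first return of [sigma(x)] to [sigma(X)] occurs at time
    [|sigma(x_0)|]. If [sigma(X) = X], all these lengths are [1], which
    contradicts the growth of [|sigma^k(a)|]. An isolated point of [X] would
    recur, hence be periodic. *)

(** * Subwords and concatenations of blocks *)

Section Subwords.
Context {K : Type}.
Implicit Types u v w s : seq K.

Lemma subword_refl w : subword w w.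
Proof. by exists [::], [::]; rewrite cats0. Qed.

Lemma subword_trans v u w : subword u v -> subword v w -> subword u w.
Proof.
move=> [p [q ->]] [p' [q' ->]]; exists (p' ++ p), (q ++ q').
by rewrite !catA.
Qed.

Lemma subword_catr w q : subword w (w ++ q).
Proof. by exists [::], q. Qed.

Lemma size_subword u w : subword u w -> (size u <= size w)%N.
Proof. by move=> [p [q ->]]; rewrite !size_cat; lia. Qed.

Lemma subword1 (a0 : K) w i : (i < size w)%N -> subword [:: nth a0 w i] w.
Proof.
move=> iw; exists (take i w), (drop i.+1 w).
by rewrite -[LHS](cat_take_drop i) (drop_nth a0).
Qed.

Lemma cat_eq_prefix u v p q : u ++ v = p ++ q -> (size u <= size p)%N ->
  exists2 r, p = u ++ r & v = r ++ q.
Proof.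
elim: u p => [|x u IH] [|y p] //=.
- by move=> ->; exists [::].
- by move=> ->; exists (y :: p).
by move=> [-> E] /(IH _ E) [r -> ->]; exists r.
Qed.

(* The word [u] is longer than two blocks, so it cannot straddle a single
   boundary between consecutive blocks without containing a full one. *)
Lemma long_subword_block (f : K -> seq K) (L : nat) w u :
  (forall a, (size (f a) <= L)%N) -> (L + L < size u)%N ->
  subword u (flatten (map f w)) -> exists a, subword (f a) u.
Proof.
move=> fL Lu [p [q E]]; elim: w p E => [|a w IH] p /= E.
  by move: (congr1 size E); rewrite !size_cat /=; lia.
have [ap|pa] := leqP (size (f a)) (size p).
  by have [r _ /IH] := cat_eq_prefix E ap.
have [r fa {}E] := cat_eq_prefix (esym E) (ltnW pa).
have rL : (size r <= L)%N.
  by move: (congr1 size fa) (fL a); rewrite size_cat; lia.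
have ru : (size r <= size u)%N by lia.
have [s us {}E] := cat_eq_prefix (esym E) ru.
have sL : (L < size s)%N.
  by move: (congr1 size us); rewrite size_cat; lia.
case: w E {IH} => [|b w] /= E.
  by move: (congr1 size E); rewrite size_cat /=; lia.
have bs : (size (f b) <= size s)%N by have := fL b; lia.
have [t st _] := cat_eq_prefix E bs.
by exists b; rewrite us st; exists r, t.
Qed.

End Subwords.

(** * Iterated substitution on words and growth of lengths *)

Section SubstitutedWords.
Context {K : Type} (sigma : K -> seq K).
Local Notation siter j := (iter j (subst_word sigma)).

Lemma subst_word_cat u v :
  subst_word sigma (u ++ v) = subst_word sigma u ++ subst_word sigma v.
Proof. by rewrite /subst_word map_cat flatten_cat. Qed.

Lemma iter_subst_cat j u v : siter j (u ++ v) = siter j u ++ siter j v.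
Proof. by elim: j => //= j ->; rewrite subst_word_cat. Qed.

Lemma iter_substE j w : siter j w = flatten (map (subst_iter sigma j) w).
Proof.
elim: w => [|a w IH] /=; last by rewrite -cat1s iter_subst_cat IH.
by elim: j => //= j ->.
Qed.

Lemma subst_iterD j k a : subst_iter sigma (j + k) a = siter j (subst_iter sigma k a).
Proof. by rewrite /subst_iter iterD. Qed.

Lemma subword_iter_subst j u v : subword u v -> subword (siter j u) (siter j v).
Proof.
by move=> [p [q ->]]; rewrite !iter_subst_cat; exists (siter j p), (siter j q).
Qed.

Lemma size_iter_subst_ge j m w : (forall a, (m <= size (subst_iter sigma j a))%N) ->
  (m * size w <= size (siter j w))%N.
Proof.
move=> jm; rewrite iter_substE.
by elim: w => [|a w IH] /=; rewrite ?muln0 // mulnS size_cat leq_add.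
Qed.

Hypothesis sigma_gt0 : forall a, (0 < size (sigma a))%N.

Lemma size_iter_subst j w : (size w <= size (siter j w))%N.
Proof.
elim: j w => //= j IH w; apply: leq_trans (IH w) _.
rewrite -[leqLHS]mul1n; apply: (@size_iter_subst_ge 1) => a.
by rewrite /subst_iter /subst_word /= cats0.
Qed.

Lemma size_subst_iter_mono i j a : (i <= j)%N ->
  (size (subst_iter sigma i a) <= size (subst_iter sigma j a))%N.
Proof. by move=> ij; rewrite -(subnK ij) subst_iterD size_iter_subst. Qed.

End SubstitutedWords.

(** * Proximity of words of equal length *)

Section WordBalls.
Context {R : realType} {K : pseudoMetricType R}.
Implicit Types (u v w s : seq K) (e d : R).

(** The product ball in [K^n], by recursion so that it splits along concatenations; words of
    different lengths are never close. *)
Fixpoint wball e u w : Prop :=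
  match u, w with
  | [::], [::] => True
  | x :: u', y :: w' => ball x e y /\ wball e u' w'
  | _, _ => False
  end.

Lemma wball_size e u w : wball e u w -> size u = size w.
Proof. by elim: u w => [|x u IH] [|y w] //= [_ /IH ->]. Qed.

Lemma wball_nthP (a : K) e u w : wball e u w <->
  size w = size u /\ forall i, (i < size u)%N -> ball (nth a u i) e (nth a w i).
Proof.
split.
  move=> uw; split; first by rewrite (wball_size uw).
  elim: u w uw => [|x u IH] [|y w] //= [xy uw] [|i] //=.
  by rewrite ltnS; exact: IH.
move=> [sz]; elim: u w sz => [|x u IH] [|y w] //= [sz] H; split; first exact: (H 0%N).
by apply: IH => // i iu; exact: (H i.+1).
Qed.

Lemma wball_refl e u : (0 < e)%R -> wball e u u.
Proof. by move=> e0; elim: u => //= x u IH; split => //; exact: ballxx. Qed.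

Lemma wball_sym e u w : wball e u w -> wball e w u.
Proof.
elim: u w => [|x u IH] [|y w] //= [xy uw].
by split; [exact: ball_sym|exact: IH].
Qed.

Lemma wball_triangle v u w e1 e2 :
  wball e1 u v -> wball e2 v w -> wball (e1 + e2) u w.
Proof.
elim: u v w => [|x u IH] [|y v] [|z w] //= [xy uv] [yz vw].
by split; [exact: ball_triangle xy yz|exact: IH uv vw].
Qed.

Lemma wball_split v u w e :
  wball (e / 2) u v -> wball (e / 2) v w -> wball e u w.
Proof. by move=> uv vw; rewrite (splitr e); exact: wball_triangle uv vw. Qed.

Lemma wball_le d e u w : (d <= e)%R -> wball d u w -> wball e u w.
Proof.
move=> de; elim: u w => [|x u IH] [|y w] //= [xy uw].
by split; [exact: le_ball xy|exact: IH].
Qed.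

Lemma wball_cat e u v u' v' :
  wball e u v -> wball e u' v' -> wball e (u ++ u') (v ++ v').
Proof.
elim: u v => [|x u IH] [|y v] //= [xy uv] uv'.
by split => //; exact: IH.
Qed.

Lemma wball_catl e u u' w : wball e (u ++ u') w ->
  exists v v', [/\ w = v ++ v', wball e u v & wball e u' v'].
Proof.
elim: u w => [|x u IH] w /=; first by exists [::], w.
case: w => [|y w] //= [xy /IH [v [v' [-> uv uv']]]].
by exists (y :: v), v'.
Qed.

Lemma wball_subword e u s t : subword u s -> wball e s t ->
  exists2 v, subword v t & wball e u v.
Proof.
move=> [p [q ->]] /wball_catl [p' [t' [-> _]]] /wball_catl [v [q' [-> uv _]]].
by exists v => //; exists p', q'.
Qed.

Lemma language_atP (sigma : K -> seq K) a w : language_at sigma a w <->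
  (0 < size w)%N /\ forall e, (0 < e)%R ->
    exists u j, subword u (subst_iter sigma j a) /\ wball e w u.
Proof.
split=> -[w0 H]; split=> // e /H.
  by move=> [u [[j uj] sz wu]]; exists u, j; split => //; apply/(wball_nthP a).
by move=> [u [j [uj /(wball_nthP a) [sz wu]]]]; exists u; split => //; exists j.
Qed.

End WordBalls.

(** * The language of a primitive generalized substitution *)

Section Language.
Context {R : realType} {K : pseudoMetricType R} {sigma : K -> seq K}.
Hypothesis alphabetK : alphabet_space K.
Hypothesis gen_sigma : gen_substitution sigma.
Hypothesis prim_sigma : primitive_subst sigma.
Implicit Types (u v w : seq K) (e d : R).
Local Notation siter j := (iter j (subst_word sigma)).

Lemma gen_subst_gt0 a : (0 < size (sigma a))%N.
Proof. by case: gen_sigma. Qed.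

(** The length is locally constant, so near [a] only finitely many letter conditions have to be met
    at once. *)
Lemma letter_continuous a e : (0 < e)%R ->
  exists2 d, (0 < d)%R & forall b, ball a d b -> wball e (sigma a) (sigma b).
Proof.
move=> e0; have [_ osz ctn] := gen_sigma.
set n := size (sigma a).
have nn : \forall b \near a, size (sigma b) = n by exact: (open_nbhs_nbhs (conj (osz n) erefl)).
have nj m : (m <= n)%N -> \forall b \near a, forall j, (j < m)%N ->
    ball (nth a (sigma a) j) e (nth b (sigma b) j).
  elim: m => [_|m IH mn]; first exact: nearW.
  have := ctn m; move/subspace_continuousP => /(_ a mn) /(_ _ (nbhsx_ballx _ _ e0)) Hm.
  have {}IH := IH (ltnW mn).
  near=> b => j; rewrite ltnS leq_eqVlt => /orP[/eqP ->|jm].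
    suff : (m < size (sigma b))%N by near: b.
    by rewrite (_ : size (sigma b) = n) //; near: b.
  by move: j jm; near: b.
have /nbhs_ballP [d d0 db] : \forall b \near a, wball e (sigma a) (sigma b).
  have {}nj := nj n (leqnn n).
  near=> b.
  have sb : size (sigma b) = n by near: b.
  apply/(wball_nthP a); split => // j jn.
  (* The index [j] is in range, so the default letter may be exchanged. *)
  rewrite [nth a (sigma b) j](set_nth_default b) ?sb //.
  by move: j jn {sb}; near: b.
by exists d.
Unshelve. all: by end_near.
Qed.

Lemma subst_word_continuous w e : (0 < e)%R ->
  exists2 d, (0 < d)%R &
    forall u, wball d w u -> wball e (subst_word sigma w) (subst_word sigma u).
Proof.
move=> e0; elim: w => [|a w [d d0 IH]]; first by exists 1%R => // -[].
have [d' d'0 H] := letter_continuous a e0.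
exists (Num.min d d'); first by rewrite lt_min d0.
case=> [|b u] //= [ab wu]; rewrite /subst_word /=.
apply: wball_cat; first by apply: H; apply: le_ball ab; rewrite ge_min lexx orbT.
by apply: IH; apply: wball_le wu; rewrite ge_min lexx.
Qed.

Lemma iter_subst_continuous j w e : (0 < e)%R ->
  exists2 d, (0 < d)%R & forall u, wball d w u -> wball e (siter j w) (siter j u).
Proof.
elim: j w e => [|j IH] w e e0; first by exists e.
have [d d0 Hd] := subst_word_continuous (siter j w) e0.
have [d' d'0 Hd'] := IH w d d0.
by exists d' => // u /Hd' /Hd.
Qed.

(** Close words have equal length, so by continuity the length is locally constant in [a], hence
    bounded by compactness. *)
Lemma size_subst_iter_bounded q : exists L, forall a, (size (subst_iter sigma q a) <= L)%N.
Proof.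
have [_ cK _ _] := alphabetK.
have /compact_near_coveringP := cK.
move=> /(_ nat \oo (fun n a => (size (subst_iter sigma q a) <= n)%N)) [].
  move=> a _.
  have [d d0 H] := iter_subst_continuous q [:: a] (@ltr01 R).
  exists (ball a d, [set n | (size (subst_iter sigma q a) <= n)%N]) => /=.
    split; first exact: nbhsx_ballx.
    by exists (size (subst_iter sigma q a)).
  move=> [b n] /= [ab]; apply: leq_trans.
  by rewrite /subst_iter -(wball_size (H [:: b] (conj ab I))).
by move=> n _ /(_ n (leqnn n)) H; exists n => a; exact: H.
Qed.

(** Two distinct letters have disjoint neighbourhoods, and by primitivity a deep enough iterate of
    every letter visits both. *)
Lemma subst_iter_size2 : exists k, forall a, (1 < size (subst_iter sigma k a))%N.
Proof.
have [hK _ _ [a [b ab]]] := alphabetK.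
move: hK; rewrite open_hausdorff => /(_ a b) [|[A B] /= [aA bB] [oA oB /eqP AB0]].
  exact/eqP.
have [i Hi] := prim_sigma oA (ex_intro _ a (set_mem aA)).
have [j Hj] := prim_sigma oB (ex_intro _ b (set_mem bB)).
exists (i + j)%N => c; rewrite ltnNge; apply/negP => sz.
have [m [mi Am]] := Hi c (i + j)%N (leq_addr _ _).
have [n [nj Bn]] := Hj c (i + j)%N (leq_addl _ _).
have mn : m = n.
  have := leq_trans mi sz; have := leq_trans nj sz.
  by rewrite !ltnS !leqn0 => /eqP -> /eqP ->.
by rewrite -mn in Bn; have : set0 (nth c (subst_iter sigma (i + j) c) m) by rewrite -AB0.
Qed.

Lemma subst_iter_size_unbounded N :
  exists k, forall a, (N <= size (subst_iter sigma k a))%N.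
Proof.
have [k0 H0] := subst_iter_size2.
elim: N => [|N [k IH]]; first by exists 0%N.
exists (k0 + k)%N => a; rewrite subst_iterD.
(* Applying [sigma^k0] at least doubles the length, and twice a positive number that is at least [N]
   exceeds [N]. *)
apply: (@leq_trans (2 * size (subst_iter sigma k a))%N).
  have := IH a.
  have : (0 < size (subst_iter sigma k a))%N.
    exact: (size_subst_iter_mono gen_subst_gt0 a (leq0n k)).
  by lia.
exact: size_iter_subst_ge.
Qed.

(* By primitivity the language seen from one letter is seen from every letter,
   at a uniform depth for a given precision. *)
Lemma language_uniform w e : language sigma w -> (0 < e)%R ->
  exists q, forall a, exists2 u, subword u (subst_iter sigma q a) & wball e w u.
Proof.
move=> [a /language_atP [w0 H]] e0.
have e20 : (0 < e / 2)%R by rewrite divr_gt0.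
have [u [j [uj wu]]] := H _ e20.
have [d d0 Hd] := iter_subst_continuous j [:: a] e20.
(* Balls need not be open, hence the interior. *)
have [|k Hk] := prim_sigma (open_interior (ball a d)).
  by exists a; exact: nbhsx_ballx.
exists (j + k)%N => b; rewrite subst_iterD.
have [i [ik /interior_subset ac]] := Hk b k (leqnn k).
set c := nth b _ i in ac.
have := Hd [:: c] (conj ac I) => /(wball_subword uj) [v vc uv].
exists v; last exact: wball_split wu uv.
apply: subword_trans vc _; apply: subword_iter_subst.
exact: subword1.
Qed.

(** The approximating words may come from different letters; [language_uniform] transfers them all
    to one letter [a]. *)
Lemma language_closed w : (0 < size w)%N ->
  (forall e, (0 < e)%R -> exists2 v, language sigma v & wball e w v) ->
  language sigma w.
Proof.
have [_ _ _ [a _]] := alphabetK.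
move=> w0 H; exists a; apply/language_atP; split => // e e0.
have e20 : (0 < e / 2)%R by rewrite divr_gt0.
have [v /language_uniform /(_ e20) [q /(_ a) [u uq vu]] wv] := H _ e20.
by exists u, q; split => //; exact: wball_split wv vu.
Qed.

Lemma language_subword u w : language sigma w -> subword u w -> (0 < size u)%N ->
  language sigma u.
Proof.
move=> [a /language_atP [w0 H]] uw u0; exists a; apply/language_atP; split => // e.
move=> /H [v [j [vj /(wball_subword uw) [v' v'v uv']]]].
by exists v', j; split => //; exact: subword_trans v'v vj.
Qed.

Lemma language_subst w : language sigma w -> language sigma (subst_word sigma w).
Proof.
move=> [a /language_atP [w0 H]]; exists a; apply/language_atP; split => [|e e0].
  exact: leq_trans w0 (size_iter_subst gen_subst_gt0 1 w).
have [d d0 Hd] := subst_word_continuous w e0.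
have [u [j [uj /Hd wu]]] := H _ d0.
exists (subst_word sigma u), j.+1; split => //.
exact: (subword_iter_subst _ 1 uj).
Qed.

Lemma language_iter a k : language sigma (subst_iter sigma k a).
Proof.
exists a; apply/language_atP; split => [|e e0].
  exact: (size_subst_iter_mono gen_subst_gt0 a (leq0n k)).
exists (subst_iter sigma k a), k; split; first exact: subword_refl.
exact: wball_refl.
Qed.

(** Up to [e / 2], the word [v] lies in some [sigma^J(c)] with [J >= q], a concatenation of blocks
    [sigma^q(b)] of length at most [L]; beyond length [2L] it contains a whole block, in which [w]
    occurs up to [e / 2]. *)
Lemma language_return w e : language sigma w -> (0 < e)%R ->
  exists N, forall v, language sigma v -> (N <= size v)%N ->
    exists2 u, subword u v & wball e w u.
Proof.
move=> Lw e0; have e20 : (0 < e / 2)%R by rewrite divr_gt0.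
have [q Hq] := language_uniform Lw e20.
have [L HL] := size_subst_iter_bounded q.
exists (L + L).+1 => v [c /language_atP [_ /(_ _ e20) [v' [J [v'J vv']]]]].
rewrite (wball_size vv') => Lv'.
(* For [J < q], monotonicity of lengths would bound the length of [v] by [L]. *)
have qJ : (q <= J)%N.
  rewrite leqNgt; apply/negP => Jq.
  have := size_subst_iter_mono gen_subst_gt0 c (ltnW Jq).
  by move: (size_subword v'J) (HL c); lia.
move: v'J; rewrite -(subnKC qJ) subst_iterD iter_substE.
move=> /(long_subword_block HL Lv') [a av'].
have [u uq wu] := Hq a.
have [u' u'v uu'] := wball_subword (subword_trans uq av') (wball_sym vv').
by exists u' => //; exact: wball_split wu uu'.
Qed.

End Language.

(** * Finite factors and translates of bi-infinite sequences *)

Section Segments.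
Local Open Scope ring_scope.
Context {K : Type}.
Implicit Types (x y : int -> K) (p q m : int) (n k : nat).

Definition segment x p n : seq K := [seq x (p + i%:Z) | i <- iota 0 n].

Lemma size_segment x p n : size (segment x p n) = n.
Proof. by rewrite size_map size_iota. Qed.

Lemma nth_segment a x p n i : (i < n)%N -> nth a (segment x p n) i = x (p + i%:Z).
Proof. by move=> ni; rewrite (nth_map 0%N) ?size_iota // nth_iota. Qed.

Lemma segment_cat x p k n :
  segment x p (k + n) = segment x p k ++ segment x (p + k%:Z) n.
Proof.
rewrite /segment iotaD map_cat add0n; congr (_ ++ _).
rewrite -[in LHS](addn0 k) iotaDl -map_comp; apply: eq_map => i /=.
by rewrite PoszD addrA.
Qed.

Lemma segmentS x p n : segment x p n.+1 = x p :: segment x (p + 1) n.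
Proof. by rewrite -add1n segment_cat /segment /= addr0. Qed.

Lemma segment_subword x p q k n : p <= q -> q + k%:Z <= p + n%:Z ->
  subword (segment x q k) (segment x p n).
Proof.
move=> pq qn; exists (segment x p (absz (q - p)%R)).
exists (segment x (q + k%:Z) (absz (p + n%:Z - (q + k%:Z))%R)).
have -> : n = (absz (q - p)%R + (k + absz (p + n%:Z - (q + k%:Z))%R))%N by lia.
rewrite segment_cat segment_cat.
congr (_ ++ (segment x _ _ ++ segment x _ _)); lia.
Qed.

Lemma subword_segment u x p n : subword u (segment x p n) ->
  exists q, [/\ p <= q, q + (size u)%:Z <= p + n%:Z & u = segment x q (size u)].
Proof.
move=> [s [t E]].
have sz : n = (size s + (size u + size t))%N.
  by rewrite -!size_cat -E size_segment.
exists (p + (size s)%:Z); split; [by lia|by lia|].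
move: E; rewrite sz segment_cat segment_cat.
move=> /(congr1 (take (size u) \o drop (size s))) /=.
by rewrite !drop_size_cat ?size_segment // !take_size_cat ?size_segment.
Qed.

Lemma windowE x n : window x n = segment x (- n%:Z) (n + n).+1.
Proof. by apply: eq_map => i; rewrite addrC. Qed.

(** All integer powers of the shift at once, its inverse included. *)
Definition translate m x : int -> K := fun i => x (i + m).

Lemma translateD p q x : translate p (translate q x) = translate (p + q) x.
Proof. by apply/funext => i; rewrite /translate addrA. Qed.

Lemma translate0 x : translate 0 x = x.
Proof. by apply/funext => i; rewrite /translate addr0. Qed.

Lemma segment_translate m x p n : segment (translate m x) p n = segment x (p + m) n.
Proof. by apply: eq_map => i; rewrite /translate addrAC. Qed.

End Segments.

Lemma iter_shift {K : topologicalType} n (x : KZ K) : iter n shift x = translate n%:Z x.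
Proof.
elim: n => [|n IH] /=; first by rewrite translate0.
apply/funext => i; rewrite IH /shift /translate; congr x; lia.
Qed.

(** * The product topology on bi-infinite sequences *)

Section SequenceTopology.
Local Open Scope ring_scope.
Context {R : realType} {K : pseudoMetricType R}.
Implicit Types (x y z : KZ K) (e : R).

Lemma coord_continuous (i : int) : continuous (fun x : KZ K => x i).
Proof. exact: (@proj_continuous int (fun _ => K) i). Qed.

Lemma compact_KZ : compact [set: K] -> compact [set: KZ K].
Proof.
move=> cK; have := @tychonoff int (fun _ => K) (fun _ => setT) (fun _ => cK).
by rewrite (_ : [set f | _] = setT) //; apply/seteqP; split.
Qed.

Lemma hausdorff_KZ : hausdorff_space K -> hausdorff_space (KZ K).
Proof. by move=> hK; exact: (@hausdorff_product int (fun _ => K)). Qed.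

Lemma zero_dimensional_KZ : zero_dimensional K -> zero_dimensional (KZ K).
Proof. by move=> zK; exact: (@zero_dimension_prod int (fun _ => K)). Qed.

Lemma cvg_coords (F : set_system (KZ K)) x : Filter F ->
  (forall i : int, (fun y : KZ K => y i) @ F --> x i) -> F --> x.
Proof.
move=> FF H; apply/cvg_sup => i; apply/cvg_image => [|A /H FA].
  (* Constant sequences show that each coordinate map is onto. *)
  by rewrite predeqE => a; split=> // _; exists (fun=> a : K).
exists ((fun y : KZ K => y i) @^-1` A); first exact: FA.
by rewrite image_preimage // predeqE => a; split=> // _; exists (fun=> a : K).
Qed.

Lemma continuous_coords {T : topologicalType} (f : T -> KZ K) :
  (forall i : int, continuous (fun t => f t i)) -> continuous f.
Proof.
by move=> cf t; apply: cvg_coords => i; exact: cf.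
Qed.

Lemma translate_continuous (m : int) : continuous (translate m : KZ K -> KZ K).
Proof. by apply: continuous_coords => i; exact: coord_continuous. Qed.

Lemma near_segment x (p : int) n e : 0 < e ->
  \forall y \near x, wball e (segment x p n) (segment y p n).
Proof.
have Fx : Filter (nbhs x) := nbhs_filter x.
move=> e0; elim: n p => [|n IH] p; first by apply: (@filterE _ (nbhs x)) => y.
have xp : \forall y \near x, ball (x p) e (y p).
  exact: coord_continuous (nbhsx_ballx _ _ e0).
by apply: filterS2 xp (IH (p + 1)) => y; rewrite !segmentS.
Qed.

(** The window conditions form a filter base, which converges to [x] because coordinate [i] lies in
    the window of radius [|i|]. *)
Lemma nbhs_window x (V : set (KZ K)) : nbhs x V ->
  exists n e, 0 < e /\ forall y, wball e (window x n) (window y n) -> V y.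
Proof.
pose B n e : set (KZ K) := fun y => wball e (window x n) (window y n).
pose F := filter_from [set ne : nat * R | 0 < ne.2] (fun ne => B ne.1 ne.2).
suff /[apply] : F --> x by move=> [[n e] /= e0 H]; exists n, e.
have FF : Filter F.
  apply: filter_from_filter; first by exists (0%N, 1) => /=.
  move=> [n e] [n' e'] /= e0 e'0.
  exists (maxn n n', Num.min e e'); first by rewrite /= lt_min e0.
  have sub y k d : (k <= maxn n n')%N -> Num.min e e' <= d ->
      B (maxn n n') (Num.min e e') y -> B k d y.
    move=> kn ed; rewrite /B !windowE => /(wball_le ed) /(wball_nthP (x 0)) [_ H].
    apply/(wball_nthP (x 0)); rewrite !size_segment; split => // i ik.
    set N := maxn n n' in kn H *.
    (* Index [i] of the smaller window is index [i + (N - k)] of the larger one. *)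
    have iN : (i + (N - k) < (N + N).+1)%N by lia.
    have := H (i + (N - k))%N; rewrite size_segment => /(_ iN).
    rewrite !nth_segment //.
    by rewrite (_ : - N%:Z + (i + (N - k))%N%:Z = - k%:Z + i%:Z) //; lia.
  by move=> y By; split; apply: (sub _ _ _ _ _ By);
    rewrite ?leq_maxl ?leq_maxr ?ge_min ?lexx ?orbT.
apply: cvg_coords => i A /nbhs_ballP [e e0 eA].
exists (absz i, e) => // y; rewrite /B !windowE => /(wball_nthP (x 0)) [_].
rewrite size_segment => /(_ (absz (i + (absz i)%:Z)%R)).
have ii : (absz (i + (absz i)%:Z)%R < (absz i + absz i).+1)%N by lia.
move=> /(_ ii); rewrite !nth_segment //.
by rewrite (_ : - (absz i)%:Z + (absz (i + (absz i)%:Z)%R)%:Z = i); [exact: eA|lia].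
Qed.

End SequenceTopology.

(** * Compactness, nonemptiness and minimality of the generalized subshift *)

Section GeneratedSubshift.
Local Open Scope ring_scope.
Context {R : realType} {K : pseudoMetricType R} {sigma : K -> seq K}.
Hypothesis alphabetK : alphabet_space K.
Hypothesis gen_sigma : gen_substitution sigma.
Hypothesis prim_sigma : primitive_subst sigma.
Implicit Types (x y z : KZ K) (e : R).
Local Notation X := (Xsigma sigma).

Lemma XsigmaP x : X x <-> forall (p : int) n, language sigma (segment x p n.+1).
Proof.
split=> [Xx p n|H n]; last by rewrite windowE.
(* The centred window of radius [|p| + n] contains the coordinates from [p] to [p + n]. *)
have := Xx (absz p + n)%N; rewrite windowE => /language_subword; apply.
  by apply: segment_subword; lia.
by rewrite size_segment.
Qed.

Lemma Xsigma_translate (m : int) x : X x -> X (translate m x).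
Proof. by move=> /XsigmaP H; apply/XsigmaP => p n; rewrite segment_translate. Qed.

Lemma Xsigma_closed : closed X.
Proof.
move=> x clx n; rewrite windowE.
apply: (language_closed alphabetK gen_sigma prim_sigma).
  by rewrite size_segment.
move=> e e0; have [y [/XsigmaP Xy xy]] := clx _ (near_segment x (- n%:Z) (n + n).+1 e0).
by exists (segment y (- n%:Z) (n + n).+1).
Qed.

Lemma Xsigma_compact : compact X.
Proof.
have [_ /compact_KZ cKZ _ _] := alphabetK.
exact: subclosed_compact Xsigma_closed cKZ _.
Qed.

(** Long iterates of a letter, centred at the origin, give sequences with longer and longer
    admissible windows; a cluster point of these in the compact [K^Z] lies in [X]. *)
Lemma Xsigma_neq0 : X !=set0.
Proof.
have [_ /compact_KZ cKZ _ [a _]] := alphabetK.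
have [x Hx] : {x : nat -> KZ K & forall n, language sigma (window (x n) n)}.
  apply: (@choice _ _ (fun n (x : KZ K) => language sigma (window x n))) => n.
  have [k Hk] := subst_iter_size_unbounded alphabetK gen_sigma prim_sigma (n + n).+1.
  (* Only the coordinates from [-n] to [n] matter; they read the first [2n + 1] letters of
     [sigma^k(a)]. *)
  exists ((fun i : int => nth a (subst_iter sigma k a) (absz (i + n%:Z)%R)) : KZ K).
  have La := language_iter gen_sigma a k.
  apply: (language_subword La); last by rewrite windowE size_segment.
  rewrite (_ : window _ _ = take (n + n).+1 (subst_iter sigma k a)).
    by rewrite -{2}(cat_take_drop (n + n).+1 (subst_iter sigma k a)); exact: subword_catr.
  apply: (@eq_from_nth _ a).
    by rewrite windowE size_segment size_takel.
  rewrite windowE size_segment => i ik; rewrite nth_segment // nth_take //.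
  by congr nth; lia.
have [z [_ zx]] : [set: KZ K] `&` cluster (x @ \oo) !=set0.
  by apply: cKZ; exact: filterT.
exists z => n; rewrite windowE.
apply: (language_closed alphabetK gen_sigma prim_sigma).
  by rewrite size_segment.
move=> e e0.
(* For [N >= n], the window of radius [n] of [x N] is part of its admissible window of radius
   [N]. *)
have [|y [[N nN <-] zy]] := zx [set x N | N in [set N | (n <= N)%N]] _ _
    (near_segment z (- n%:Z) (n + n).+1 e0).
  by exists n => // N nN; exists N.
exists (segment (x N) (- n%:Z) (n + n).+1) => //.
apply: (language_subword (Hx N)); last by rewrite size_segment.
by rewrite windowE; apply: segment_subword; move: nN => /=; lia.
Qed.

Lemma Xsigma_return y z (V : set (KZ K)) : X y -> X z -> nbhs z V ->
  exists n, V (iter n shift y).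
Proof.
move=> /XsigmaP Xy Xz /nbhs_window [n [e [e0 HV]]].
have [N HN] := language_return alphabetK gen_sigma prim_sigma (Xz n) e0.
(* The search starts at coordinate [0] of [y], so [q >= 0]; shifting by [q + n] then centres the
   occurrence at the origin. *)
have [|u /subword_segment [q [q0 _ uE]] zu] := HN _ (Xy 0 N).
  by rewrite size_segment.
exists (absz (q + n%:Z)%R); apply: HV; rewrite iter_shift [window (translate _ _) _]windowE.
rewrite segment_translate (_ : - _ + _ = q); last by lia.
by have := zu; rewrite uE -(wball_size zu) windowE size_segment.
Qed.

Lemma iter_shift_Xsigma n x : X x -> X (iter n shift x).
Proof. by rewrite iter_shift; exact: Xsigma_translate. Qed.

(** Forward orbits are dense in [X] by [Xsigma_return], so a nonempty closed forward-invariant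
    subset is everything. *)
Lemma Xsigma_minimal : minimal_system X shift.
Proof.
split; [exact: Xsigma_neq0|by move=> x; exact: (@iter_shift_Xsigma 1)|].
move=> C [V [cV ->]] [y Cy] CS; apply/seteqP; split=> [x []//|z Xz]; split=> //.
apply: cV => U nU.
have [n Un] := Xsigma_return (proj1 Cy) Xz nU.
exists (iter n shift y); split => //.
suff [] : (X `&` V) (iter n shift y) by [].
by elim: n {Un} => // n; exact: CS.
Qed.

End GeneratedSubshift.

(** * Block boundaries in a substituted sequence *)

Section BlockPositions.
Local Open Scope ring_scope.
Context {K : Type} {sigma : K -> seq K}.
Hypothesis sigma_gt0 : forall a, (0 < size (sigma a))%N.
Implicit Types (x y : int -> K) (k l p : int) (n j : nat).
Local Notation bpos := (bpos sigma).

Lemma bpos0 x : bpos x 0 = 0.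
Proof. exact: big_ord0. Qed.

Lemma bposS x k : bpos x (k + 1) = bpos x k + (size (sigma (x k)))%:Z.
Proof.
case: k => n; first by rewrite -PoszD addn1 /= big_ord_recr.
(* The successor of [Negz 0] is [0], where the definition of [bpos] changes branch. *)
case: n => [|n].
  by rewrite (_ : Negz 0 + 1 = 0) // bpos0 /= big_ord_recr big_ord0 /= add0r addNr.
rewrite (_ : Negz n.+1 + 1 = Negz n); last by lia.
rewrite /= [in RHS]big_ord_recr /= opprD -addrA.
by rewrite -[LHS]addr0; congr (_ + _); apply/esym; exact: addNr.
Qed.

(** Serves to compare [bpos] with its translates and with the cuts given by recognizability. *)
Lemma bpos_unique x (f : int -> int) :
  (forall k, f (k + 1) = f k + (size (sigma (x k)))%:Z) ->
  forall k, f k = f 0 + bpos x k.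
Proof.
move=> fS; elim/int_ind => [|n IH|n IH]; first by rewrite bpos0 addr0.
  by rewrite -addn1 PoszD fS bposS IH addrA.
have E : - n%:Z = - n.+1%:Z + 1 :> int by lia.
by move: IH; rewrite E fS bposS; lia.
Qed.

Lemma bpos_translate x k l : bpos (translate l x) k = bpos x (k + l) - bpos x l.
Proof.
have := @bpos_unique (translate l x) (fun k => bpos x (k + l)) _ k.
rewrite add0r => -> //; first lia.
by move=> i; rewrite addrAC bposS.
Qed.

Lemma bpos_segment x k n :
  bpos x (k + n%:Z) = bpos x k + (size (subst_word sigma (segment x k n)))%:Z.
Proof.
elim: n k => [|n IH] k; first by rewrite !addr0.
rewrite segmentS /subst_word /= size_cat PoszD addrA -bposS -IH.
by congr bpos; lia.
Qed.

Lemma bpos_growth x k n : bpos x k + n%:Z <= bpos x (k + n%:Z).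
Proof.
elim: n => [|n IH]; first by rewrite !addr0.
rewrite (_ : k + n.+1%:Z = k + n%:Z + 1); last by lia.
rewrite bposS.
by have := sigma_gt0 (x (k + n%:Z)); lia.
Qed.

Lemma bpos_lt x k l : k < l -> bpos x k + (size (sigma (x k)))%:Z <= bpos x l.
Proof.
move=> kl; rewrite -bposS (_ : l = k + 1 + (absz (l - (k + 1))%R)%:Z); last by lia.
by have := bpos_growth x (k + 1) (absz (l - (k + 1))%R); lia.
Qed.

(** Consecutive nonempty blocks do not overlap. Together with [bpos_surj] this says that blocks tile
    the integers, which makes the image sequence exist and be unique. *)
Lemma bpos_inj x k l i j : (i < size (sigma (x k)))%N -> (j < size (sigma (x l)))%N ->
  bpos x k + i%:Z = bpos x l + j%:Z -> k = l /\ i = j.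
Proof.
move=> ik jl E.
have [kl|lk|kl] := ltgtP k l; last by subst l; split => //; lia.
  by have := bpos_lt x kl; lia.
by have := bpos_lt x lk; lia.
Qed.

Lemma bpos_surj x p : exists k j, (j < size (sigma (x k)))%N /\ p = bpos x k + j%:Z.
Proof.
elim/int_ind: p => [|n [k [j [jk E]]]|n [k [j [jk E]]]].
- by exists 0, 0%N; rewrite bpos0.
- have [jk'|kj] := ltnP j.+1 (size (sigma (x k))); first by exists k, j.+1; split => //; lia.
  by exists (k + 1), 0%N; split => //; rewrite bposS; lia.
- case: j => [|j] in jk E *; last by exists k, j; split; lia.
  (* Stepping left from the first letter of a block reaches the last letter of the preceding
     block. *)
  have := bposS x (k - 1); rewrite subrK => E'.
  have := sigma_gt0 (x (k - 1)) => s0.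
  by exists (k - 1), (size (sigma (x (k - 1)))).-1; split; lia.
Qed.

Lemma subst_seq_rel_unique x y y' :
  subst_seq_rel sigma x y -> subst_seq_rel sigma x y' -> y = y'.
Proof.
move=> xy xy'; apply/funext => p.
by have [k [j [jk ->]]] := bpos_surj x p; rewrite xy ?xy'.
Qed.

Lemma subst_seq_rel_exists x : exists y, subst_seq_rel sigma x y.
Proof.
pose P p (kj : int * nat) := (kj.2 < size (sigma (x kj.1)))%N /\ p = bpos x kj.1 + kj.2%:Z.
have [f Hf] : {f : int -> int * nat & forall p, P p (f p)}.
  apply: (@choice _ _ P) => p; have [k [j H]] := bpos_surj x p.
  by exists (k, j).
exists (fun p => nth (x (f p).1) (sigma (x (f p).1)) (f p).2) => k j jk.
have [jf /esym E] := Hf (bpos x k + j%:Z).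
by have [-> ->] := bpos_inj jf jk E.
Qed.

Lemma segment_subst x y k n : subst_seq_rel sigma x y ->
  segment y (bpos x k) (size (subst_word sigma (segment x k n))) =
  subst_word sigma (segment x k n).
Proof.
move=> xy; elim: n k => [|n IH] k //.
rewrite segmentS /subst_word /= size_cat segment_cat; congr (_ ++ _).
  apply: (@eq_from_nth _ (x k)) => [|j]; rewrite size_segment // => jk.
  by rewrite nth_segment // xy.
by rewrite -bposS IH.
Qed.

Lemma segment_subst1 x y k : subst_seq_rel sigma x y ->
  segment y (bpos x k) (size (sigma (x k))) = sigma (x k).
Proof.
move=> xy; have := segment_subst k 1 xy.
by rewrite /segment /subst_word /= addr0 cats0.
Qed.

End BlockPositions.

(** * The action of the substitution on bi-infinite sequences *)

Section SubstitutionAction.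
Local Open Scope ring_scope.
Context {R : realType} {K : pseudoMetricType R} {sigma : K -> seq K}.
Hypothesis gen_sigma : gen_substitution sigma.
Implicit Types (x y z : KZ K) (e : R).
Local Notation bpos := (bpos sigma).
Local Notation X := (Xsigma sigma).
Let sigma_gt0 := gen_subst_gt0 gen_sigma.

Lemma subst_seqP x : subst_seq_rel sigma x (subst_seq sigma x).
Proof.
have [y xy] := subst_seq_rel_exists sigma_gt0 x.
exact: (@xgetI _ x [set y : KZ K | subst_seq_rel sigma x y] y xy).
Qed.

Lemma subst_seq_unique x y : subst_seq_rel sigma x y -> y = subst_seq sigma x.
Proof. by move=> xy; exact: (subst_seq_rel_unique sigma_gt0 xy (@subst_seqP x)). Qed.

Lemma subst_seq_translate (m : int) x :
  subst_seq sigma (translate m x) = translate (bpos x m) (subst_seq sigma x).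
Proof.
apply/esym/subst_seq_unique => k j jk.
rewrite bpos_translate /translate -(@subst_seqP _ (k + m) _ jk).
by congr (subst_seq _ _ _); lia.
Qed.

Lemma subst_seq_shift x : subst_seq sigma (shift x) =
  iter (size (sigma (x 0))) shift (subst_seq sigma x).
Proof.
rewrite (_ : shift x = translate 1 x) // subst_seq_translate iter_shift.
by rewrite -{1}[1]add0r bposS bpos0 add0r.
Qed.

Lemma Xsigma_subst x : X x -> X (subst_seq sigma x).
Proof.
move=> /XsigmaP Xx; apply/XsigmaP => p n.
(* Boundaries grow at least linearly, so the image of the window of radius [N] covers the
   coordinates from [p] to [p + n]. *)
pose N := (absz p + n)%N.
have := language_subst gen_sigma (Xx (- N%:Z) (N + N)%N).
rewrite -(segment_subst _ _ (@subst_seqP x)) => /language_subword; apply; last first.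
  by rewrite size_segment.
have := bpos_segment (sigma := sigma) x (- N%:Z) (N + N).+1.
have := bpos_growth sigma_gt0 x (- N%:Z) N.
have := bpos_growth sigma_gt0 x 0 N.+1.
rewrite addNr bpos0 (_ : - N%:Z + (N + N).+1%:Z = 0 + N.+1%:Z); last by lia.
move=> H1 H2 H3; apply: segment_subword; last (rewrite -H3; move: H1).
  by move: H2; rewrite /N; lia.
by apply: le_trans; rewrite /N; lia.
Qed.

Lemma subst_seq_continuous : continuous (subst_seq sigma : KZ K -> KZ K).
Proof.
apply: continuous_coords => p x A /nbhs_ballP [e e0 eA].
pose N := (absz p).+1.
(* The first condition fixes the length of [sigma(x[-N,-1])], hence the boundary [bpos x (-N)]; the
   second makes the letters of [sigma(x[-N,N-1])] close, the one at coordinate [p] among them. *)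
have [d1 d10 H1] := subst_word_continuous gen_sigma (segment x (- N%:Z) N) e0.
have [d2 d20 H2] := subst_word_continuous gen_sigma (segment x (- N%:Z) (N + N)) e0.
have Fx : Filter (nbhs x) := nbhs_filter x.
apply: filterS2 (near_segment x (- N%:Z) N d10) (near_segment x (- N%:Z) (N + N) d20).
move=> y /H1 /wball_size E /H2 xy; apply: eA.
have left z : bpos z (- N%:Z) = - (size (subst_word sigma (segment z (- N%:Z) N)))%:Z.
  have := bpos_segment (sigma := sigma) z (- N%:Z) N.
  by rewrite addNr bpos0 => /esym/eqP; rewrite addr_eq0 => /eqP.
have Exy : bpos y (- N%:Z) = bpos x (- N%:Z) by rewrite !left E.
have le : bpos x (- N%:Z) <= - N%:Z.
  by have := bpos_growth sigma_gt0 x (- N%:Z) N; rewrite addNr bpos0; lia.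
pose j := absz (p - bpos x (- N%:Z))%R.
have jp : p = bpos x (- N%:Z) + j%:Z by rewrite /j; move: le; rewrite /N; lia.
have js : (j < size (subst_word sigma (segment x (- N%:Z) (N + N))))%N.
  rewrite -ltz_nat -(ltrD2l (bpos x (- N%:Z))) -jp -bpos_segment.
  rewrite (_ : - N%:Z + (N + N)%N%:Z = 0 + N%:Z); last by lia.
  by apply: lt_le_trans (bpos_growth sigma_gt0 x 0 N); rewrite bpos0 /N; lia.
have coord z : bpos z (- N%:Z) = bpos x (- N%:Z) ->
    (j < size (subst_word sigma (segment z (- N%:Z) (N + N))))%N ->
    subst_seq sigma z p = nth (x p) (subst_word sigma (segment z (- N%:Z) (N + N))) j.
  move=> bz jz; rewrite -(segment_subst _ _ (@subst_seqP z)) nth_segment // bz.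
  by rewrite -jp.
rewrite !coord // -?(wball_size xy) //.
by have /(wball_nthP (x p)) [_] := xy; exact.
Qed.

End SubstitutionAction.

(** * Continuous injections of compact sets *)

Section CompactHomeomorphism.
Context {T T' : topologicalType}.

Lemma compact_inj_homeo_on (X : set T) (f : T -> T') :
  hausdorff_space T' -> X !=set0 -> compact X -> {within X, continuous f} ->
  (forall x y, X x -> X y -> f x = f y -> x = y) -> homeo_on X (f @` X) f.
Proof.
move=> hT' [x0 _] cX cf injf.
pose g y := xget x0 [set x | X x /\ f x = y].
have gP y : (f @` X) y -> X (g y) /\ f (g y) = y.
  by move=> [x Xx fx]; exact: (@xgetI _ x0 [set x | X x /\ f x = y] x).
split; [by move=> x Xx; exists x|by []|exists g; split].
- by move=> y /gP [].
- move=> x Xx; have [Xg fg] : X (g (f x)) /\ f (g (f x)) = f x by apply: gP; exists x.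
  exact: injf.
- by move=> y /gP [].
apply/subspace_continuousP => y Yy V nV.
(* A closed set, being the image of a compact one, that misses [y]; at points of the image of [X]
   off [F], the inverse [g] lands in [V]. *)
pose F := f @` (X `&` ~` V°).
have cF : closed F.
  apply: compact_closed hT' _; apply: continuous_compact.
    by apply: continuous_subspaceW cf => x [].
  by apply: compact_closedI => //; apply: open_closedC; exact: open_interior.
have : nbhs y (~` F).
  apply: open_nbhs_nbhs; split; first exact: closed_openC.
  move=> [x [Xx nVx] fx]; apply: nVx.
  have [Xg fg] := gP y Yy.
  by rewrite (injf x (g y)) // fg.
apply: filterS => y' nFy' Yy'; apply: contrapT => nV'.
have [Xg fg] := gP y' Yy'.
by apply: nFy'; exists (g y') => //; split => // /interior_subset.
Qed.

End CompactHomeomorphism.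

(** * Unique desubstitution under recognizability *)

Section Recognizability.
Local Open Scope ring_scope.
Context {R : realType} {K : pseudoMetricType R} {sigma : K -> seq K}.
Hypothesis gen_sigma : gen_substitution sigma.
Hypothesis recog_sigma : recognizable sigma.
Implicit Types (x y z : KZ K).
Local Notation bpos := (bpos sigma).
Local Notation X := (Xsigma sigma).
Let sigma_gt0 := gen_subst_gt0 gen_sigma.

Lemma cutE z (a b : int) : a < b -> cut z a b = segment z a (absz (b - a)%R).
Proof. by rewrite /cut => ->. Qed.

(** The normalized cut [n 0 <= 0 < n 1] puts coordinate [0] at offset [m = - n 0] inside the block
    of [x 0]. *)
Lemma Xsigma_desubst z : X z -> exists x m,
  [/\ X x, (m < size (sigma (x 0)))%N & z = translate m%:Z (subst_seq sigma x)].
Proof.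
move=> /recog_sigma [[n x] [/= [Xx /andP[n0 n1] Hcut] _]].
(* A [cut] whose ends do not increase is empty, whereas blocks are not. *)
have nlt k : n k < n (k + 1).
  rewrite ltNge; apply/negP => h; have := sigma_gt0 (x k).
  by rewrite Hcut /cut ltNge h.
have nS k : n (k + 1) = n k + (size (sigma (x k)))%:Z.
  by rewrite Hcut cutE // size_segment gez0_abs ?subr_ge0 ?ltW // [RHS]addrC subrK.
have nE := bpos_unique nS.
have sz : 0 < n 0 + (size (sigma (x 0)))%:Z.
  by rewrite -nS add0r.
pose m := absz (n 0).
have nm : n 0 = - m%:Z by rewrite /m; lia.
exists x, m; split => //; first by rewrite -ltz_nat -subr_gt0 addrC -nm.
have -> : subst_seq sigma x = translate (n 0) z.
  apply/esym/(subst_seq_unique gen_sigma) => k j jk.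
  rewrite Hcut cutE // nS nth_segment; last first.
    rewrite (_ : absz _ = size (sigma (x k))) //.
    by rewrite addrAC subrr add0r.
  by rewrite (nE k) /translate [in LHS]addrC addrA.
by rewrite translateD nm addrN translate0.
Qed.

(** Each presentation gives normalized cuts, [bpos] minus the offset, of the same point. Uniqueness
    identifies the sequences, and the cuts at index [0], where [bpos] vanishes, identify the
    offsets. *)
Lemma recognizable_unique x y m n : X x -> X y ->
  (m < size (sigma (x 0%R)))%N -> (n < size (sigma (y 0%R)))%N ->
  X (translate m%:Z (subst_seq sigma x)) ->
  translate m%:Z (subst_seq sigma x) = translate n%:Z (subst_seq sigma y) ->
  x = y /\ m = n.
Proof.
move=> Xx Xy mx ny Xz E.
have [nx [_ Hu]] := recog_sigma Xz.
have H w k : X w -> (k < size (sigma (w 0%R)))%N ->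
    translate m%:Z (subst_seq sigma x) = translate k%:Z (subst_seq sigma w) ->
    nx = ((fun i => bpos w i - k%:Z), w).
  move=> Xw kw Ew; apply: Hu; split => //.
    change (bpos w 0 - k%:Z <= 0 < bpos w (0 + 1) - k%:Z).
    by rewrite bposS bpos0 !add0r oppr_le0 subr_gt0 ltz_nat kw.
  move=> i; change (sigma (w i) = cut (translate m%:Z (subst_seq sigma x))
    (bpos w i - k%:Z) (bpos w (i + 1) - k%:Z)).
  rewrite bposS cutE; last first.
    by rewrite ltrD2r ltrDl ltz_nat.
  rewrite Ew segment_translate subrK (_ : absz _ = size (sigma (w i))).
    by rewrite segment_subst1 //; exact: (@subst_seqP _ _ _ gen_sigma w).
  by rewrite opprD opprK addrACA addNr addr0 addrAC subrr add0r.
have := H _ _ Xy ny E; rewrite (H _ _ Xx mx erefl) => -[Eb ->].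
split => //; have := congr1 (fun f => f 0) Eb.
by rewrite !bpos0 !sub0r => /oppr_inj [].
Qed.

Lemma subst_seq_inj x y : X x -> X y -> subst_seq sigma x = subst_seq sigma y -> x = y.
Proof.
move=> Xx Xy E; have Xs := Xsigma_subst gen_sigma Xx.
by have [] // := @recognizable_unique x y 0 0 Xx Xy; rewrite ?translate0.
Qed.

(** Otherwise the same point would also have offset [0]. This yields both the openness of [sigma(X)]
    in [X] and the first return time. *)
Lemma translate_subst_notin x m : X x -> (0 < m < size (sigma (x 0%R)))%N ->
  ~ (subst_seq sigma @` X) (translate m%:Z (subst_seq sigma x)).
Proof.
move=> Xx /andP[m0 mx] [y Xy E].
have Xz : X (translate m%:Z (subst_seq sigma x)) by rewrite -E; exact: Xsigma_subst.
have Exy : translate m%:Z (subst_seq sigma x) = translate 0%:Z (subst_seq sigma y).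
  by rewrite translate0.
have [_ m0'] := recognizable_unique Xx Xy mx (sigma_gt0 _) Xz Exy.
by rewrite m0' in m0.
Qed.

End Recognizability.

(** * The Cantor property and the induced system *)

Section Induced.
Local Open Scope ring_scope.
Context {R : realType} {K : pseudoMetricType R} {sigma : K -> seq K}.
Hypothesis alphabetK : alphabet_space K.
Hypothesis gen_sigma : gen_substitution sigma.
Hypothesis prim_sigma : primitive_subst sigma.
Implicit Types (x y z : KZ K).
Local Notation X := (Xsigma sigma).
Let hKZ : hausdorff_space (KZ K).
Proof. by case: alphabetK => hK _ _ _; exact: hausdorff_KZ. Qed.
Let sigma_gt0 := gen_subst_gt0 gen_sigma.
Let X_neq0 := Xsigma_neq0 alphabetK gen_sigma prim_sigma.
Let X_compact := Xsigma_compact alphabetK gen_sigma prim_sigma.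

Lemma Xsigma_shift_homeo : homeo_on X X shift.
Proof.
split=> [x /(Xsigma_translate 1)//||].
  by apply: continuous_subspaceT; exact: (@translate_continuous _ _ 1).
exists (translate (- 1)); split.
- by move=> x; exact: Xsigma_translate.
- by move=> x _; rewrite (translateD _ 1) addNr translate0.
- by move=> x _; rewrite -[LHS]/(translate 1 (translate (- 1) x)) translateD addrN translate0.
by apply: continuous_subspaceT; exact: translate_continuous.
Qed.

Lemma Xsigma_cantor : aperiodic sigma -> cantor_set X.
Proof.
move=> aper; split=> [//|//|x V Xx oV Vx|x V Xx oV Vx].
  have [_ /compact_KZ cKZ /zero_dimensional_KZ zKZ _] := alphabetK.
  have nV : nbhs x V by exact: open_nbhs_nbhs.
  have [D [Dx [oD cD]] DV] := zero_dimensional_cvg hKZ zKZ cKZ nV.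
  exists (X `&` D); split; [by split; exists D|by []|].
  by apply: subset_trans DV => y [].
have nV : nbhs x V by exact: open_nbhs_nbhs.
(* Starting from [shift x] makes the return time positive, so aperiodicity excludes a return to [x]
   itself. *)
have [n Vn] := Xsigma_return alphabetK gen_sigma prim_sigma
  (iter_shift_Xsigma 1 Xx) Xx nV.
rewrite -iterD addn1 in Vn.
exists (iter n.+1 shift x); split => //; first exact: iter_shift_Xsigma.
by move=> xn; apply: aper; exists x; split => //; exists n.+1.
Qed.

Lemma subst_image_compact (D : set (KZ K)) : closed D ->
  compact (subst_seq sigma @` (X `&` D)).
Proof.
move=> cD; apply: continuous_compact; last exact: compact_closedI.
by apply: continuous_subspaceT; exact: subst_seq_continuous.
Qed.

(** The complement is a union of open length classes. *)
Lemma long_block_closed m : closed [set x : KZ K | (m < size (sigma (x 0%R)))%N].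
Proof.
have [_ osz _] := gen_sigma.
rewrite (_ : mkset _ = (fun x : KZ K => x 0%R) @^-1`
  (~` \bigcup_(n in `I_m.+1) [set a | size (sigma a) = n])).
  apply: preimage_closed => [x _|]; first exact: coord_continuous.
  by apply: open_closedC; apply: bigcup_open => n _; exact: osz.
apply/seteqP; split => x /=; first by move=> mx [n /= nm E]; rewrite E ltnNge -ltnS nm in mx.
move=> H; rewrite ltnNge; apply/negP => h; apply: H.
by exists (size (sigma (x 0))).
Qed.

Lemma subst_image_clopen : recognizable sigma ->
  rel_clopen X (subst_seq sigma @` X).
Proof.
move=> recog; split; last first.
  exists (subst_seq sigma @` X); split; last first.
    by apply/seteqP; split=> [z [x Xx <-]|z []//]; split; [exact: Xsigma_subst|exists x].
  apply: compact_closed hKZ _; rewrite -[X in _ @` X]setIT.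
  exact/subst_image_compact/closedT.
(* [L] bounds every block length, so only offsets [m < L] occur; [D m] collects the points at offset
   [m] in their block. *)
have [L HL] := size_subst_iter_bounded alphabetK gen_sigma 1.
pose D m : set (KZ K) := translate m%:Z @`
  (subst_seq sigma @` (X `&` [set x | (m < size (sigma (x 0%R)))%N])).
exists (~` \bigcup_(m in `I_L `\ 0%N) D m); split.
  apply: closed_openC; apply: closed_bigcup; first exact: finite_setD.
  move=> m _; apply: compact_closed hKZ _; apply: continuous_compact.
    by apply: continuous_subspaceT; exact: translate_continuous.
  exact/subst_image_compact/long_block_closed.
apply/seteqP; split=> z.
  move=> [x Xx <-]; split; first exact: Xsigma_subst.
  move=> [m [/= mL m0] [_ [y [Xy my] <-] E]].
  have m0' : (0 < m)%N by rewrite lt0n; apply/eqP.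
  apply: (@translate_subst_notin _ _ _ gen_sigma recog y m) => //; first by rewrite m0'.
  by rewrite E; exists x.
move=> [Xz nD]; have [x [m [Xx mx zE]]] := Xsigma_desubst gen_sigma recog Xz.
case: m => [|m] in mx zE; first by exists x => //; rewrite zE translate0.
exfalso; apply: nD; exists m.+1; last by exists (subst_seq sigma x) => //; exists x.
split => //=; apply: leq_trans mx _.
by have := HL (x 0); rewrite /subst_iter /subst_word /= cats0.
Qed.

Lemma subst_image_proper : recognizable sigma -> subst_seq sigma @` X <> X.
Proof.
move=> recog E.
(* In a longer block, the point at offset [1] would be in [X] but outside [sigma(X)]. *)
have size1 x i : X x -> size (sigma (x i)) = 1%N.
  move=> Xx; apply/eqP; rewrite eqn_leq sigma_gt0 andbT leqNgt; apply/negP => h.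
  pose y : KZ K := translate i x.
  have Xy : X y by exact: Xsigma_translate.
  have yi : (0 < 1 < size (sigma (y 0%R)))%N by rewrite /y /translate add0r.
  apply: (translate_subst_notin gen_sigma recog Xy yi).
  by rewrite E; apply: Xsigma_translate => //; exact: Xsigma_subst.
(* Since [sigma(x_0)] is the single letter of [sigma(x)] at coordinate [0], the induction passes
   from [x] to [sigma(x)]. *)
have iter1 k x : X x -> size (subst_iter sigma k (x 0)) = 1%N.
  elim: k x => // k IH x Xx; rewrite -addn1 subst_iterD.
  have s1 := size1 x 0 Xx.
  have := segment_subst1 0 (@subst_seqP _ _ _ gen_sigma x).
  rewrite s1 bpos0 /segment /= addr0 /subst_iter /subst_word /= cats0 => <-.
  by apply: IH; exact: Xsigma_subst.
have [x Xx] := X_neq0.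
have [k /(_ (x 0))] := subst_iter_size2 alphabetK prim_sigma.
by rewrite iter1.
Qed.

Lemma subst_conj_to_induced : recognizable sigma ->
  conj_to_induced X shift (subst_seq sigma @` X) (subst_seq sigma).
Proof.
move=> recog; split.
  apply: compact_inj_homeo_on => //; last exact: subst_seq_inj.
  by apply: continuous_subspaceT; exact: subst_seq_continuous.
(* The image of [shift x] starts one block further on, and all earlier positive times fall strictly
   inside the block. *)
move=> x Xx; exists (size (sigma (x 0))); split => //.
- exact: subst_seq_shift.
- by exists (shift x) => //; exact: (Xsigma_translate 1 Xx).
by move=> m mx; rewrite iter_shift; exact: translate_subst_notin.
Qed.

End Induced.

Theorem mainTheorem3 (R : realType) (K : pseudoMetricType R)
    (sigma : K -> seq K) :
  alphabet_space K -> gen_substitution sigma -> primitive_subst sigma ->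
  minimal_system (Xsigma sigma) shift /\
  (recognizable sigma -> aperiodic sigma ->
     [/\ minimal_cantor_system (Xsigma sigma) shift,
         self_induced (Xsigma sigma) shift,
         rel_clopen (Xsigma sigma) (subst_seq sigma @` Xsigma sigma) &
         conj_to_induced (Xsigma sigma) shift
           (subst_seq sigma @` Xsigma sigma) (subst_seq sigma)]).
Proof.
move=> alphabetK gen_sigma prim_sigma.
have min_X := Xsigma_minimal alphabetK gen_sigma prim_sigma.
split=> // recog aper.
have clopen_U := subst_image_clopen alphabetK gen_sigma prim_sigma recog.
have conj_U := subst_conj_to_induced alphabetK gen_sigma prim_sigma recog.
split=> //.
  split=> //; first exact: Xsigma_cantor.
  exact: Xsigma_shift_homeo.
exists (subst_seq sigma @` Xsigma sigma); split=> //; last by exists (subst_seq sigma).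
  have [x Xx] := Xsigma_neq0 alphabetK gen_sigma prim_sigma.
  by exists (subst_seq sigma x); exists x.
exact: subst_image_proper.
Qed.
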